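(* Let $a$ be a totally real algebraic integer. If $a$ is sparse (that is, if the $a$-convex hull $D(a)$ of $\{0,1\}$ in $\mathbb{R}$ has no limit points), then every algebraic conjugate of $a$ distinct from $a$ lies in the open interval $(0,1)$.
   Context: An algebraic number is totally real if all of its algebraic conjugates (the complex roots of its minimal polynomial over $\mathbb{Q}$) are real numbers. For $a \in \mathbb{R}$, a set $V \subseteq \mathbb{R}^n$ is called $a$-convex if for all $\mathbf{x}, \mathbf{y} \in V$ one has $a\mathbf{x} + (1-a)\mathbf{y} \in V$. The $a$-convex hull of a set $V\subseteq\mathbb{R}^n$ is the intersection of all $a$-convex subsets of $\mathbb{R}^n$ that contain $V$. $D(a)$ denotes the $a$-convex hull of $\{0,1\}$ in $\mathbb{R}$. Equivalently, set $D_0(X) = \{0,1\}$, $D_{n+1}(X) = \{ X f(X) + (1-X) g(X) : f, g \in D_n(X)\}$ for $n \ge 0$, and $D(X) = \bigcup_{n \ge 0} D_n(X) \subseteq \mathbb{Z}[X]$; then $D(a) = \{ f(a) : f \in D(X)\}$. A real number $a$ is called sparse if $D(a)$ has no limit points (in $\mathbb{R}$). *)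

(* Defs.v *)
From HB Require Import structures.
From mathcomp Require Import all_boot all_order all_algebra.
From mathcomp Require Import boolp classical_sets reals topology normedtype.
From mathcomp Require Import complex.

Set Implicit Arguments.
Unset Strict Implicit.
Unset Printing Implicit Defensive.

Import Order.TTheory GRing.Theory Num.Theory.
Import numFieldNormedType.Exports.

Local Open Scope classical_set_scope.
Local Open Scope ring_scope.
Local Open Scope complex_scope.

Definition minimal_poly (L : fieldType) (x : L) (p : {poly rat}) : Prop :=
  [/\ p \is monic, root (map_poly ratr p) x &
      forall q : {poly rat},
        q != 0 -> root (map_poly ratr q) x -> (size p <= size q)%N].

Definition conjugate (R : realType) (a : R) (z : R[i]) : Prop :=
  exists2 p : {poly rat}, minimal_poly a p & root (map_poly ratr p) z.

(* A totally real number is one of its own conjugates, hence real: taking a in R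
   rather than in R[i] loses nothing. *)
Definition totally_real (R : realType) (a : R) : Prop :=
  algebraicOver ratr a /\
  forall z : R[i], conjugate a z -> exists b : R, z = b%:C.

Definition algebraic_integer (R : realType) (a : R) : Prop :=
  integralOver (intr : int -> R) a.

Definition a_convex (R : realType) (E : lmodType R) (a : R) (V : set E) : Prop :=
  forall x y : E, V x -> V y -> V (a *: x + (1 - a) *: y).

Definition a_hull (R : realType) (E : lmodType R) (a : R) (V : set E) : set E :=
  smallest (a_convex a) V.

(* R^o is R as a module over itself, i.e. the case n = 1 of R^n. *)
Definition D (R : realType) (a : R) : set R :=
  @a_hull R R^o a [set 0; 1].

Definition sparse (R : realType) (a : R) : Prop :=
  limit_point (D a) = set0.

(* Main.v *)
Require Import Defs.
From mathcomp Require Import all_boot all_order all_algebra.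
From mathcomp Require Import boolp classical_sets cardinality reals topology normedtype.
From mathcomp Require Import sequences complex ring lra.

Import Order.TTheory GRing.Theory Num.Theory.
Import numFieldNormedType.Exports.

Local Open Scope classical_set_scope.
Local Open Scope ring_scope.
Local Open Scope complex_scope.

(** Let [b] be a real conjugate of [a] outside [(0,1)]. The conjugation
    [f(a) |-> f(b)] is well defined and injective on [D(a)].

    Suppose that some [C] in [D(X)] satisfies [C(a) < 0] and [C(b) > 1]. For [x]
    and [d] in [D(a)], passing from [x] to [C x + (1 - C) d] overshoots [d] in the
    place [a], and in the place [b] moves [x] away from [d]. Products of
    [(1 - C)^2] and [1 - C + C^2] are dense enough for the following to hold in a
    large interval [I = [1 - L, L]]: every [x] of [D(a)] in [I] has some [d <> x]
    of [D(a)] in [I] such that [C x + (1 - C) d] is still in [I]. By sparsity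
    [D(a)] has finitely many points in [I], and the one with the largest conjugate
    gives a contradiction.

    If [a < 0 < 1 < b], take [C = X], and symmetrically [C = 1 - X]. Otherwise,
    up to [X |-> 1 - X], both [a] and [b] exceed 1. Being distinct, they order
    some pair of monomials [y = X^k (1 - X)^(2n)] and [z = X^(2n)] differently,
    and then [C = X^N y + (1 - X^N) z] with [N] large works, up to [C |-> 1 - C]. *)

Lemma expr_unbounded (R : archiRealFieldType) (a K : R) : 1 < a ->
  exists N, forall n, (N <= n)%N -> K < a ^+ n.
Proof.
move=> a1; have a10 : 0 < a - 1 by lra.
have bern n : 1 + n%:R * (a - 1) <= a ^+ n.
  elim: n => [|n IHn]; first by rewrite expr0; lra.
  have : 0 <= n%:R * (a - 1) ^+ 2 by rewrite mulr_ge0 ?sqr_ge0.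
  have : a * (1 + n%:R * (a - 1)) <= a * a ^+ n by rewrite ler_wpM2l //; lra.
  by rewrite [a ^+ n.+1]exprS -natr1 => h1 h2; lra.
have := archi_boundP (normr_ge0 (K / (a - 1))).
set N := Num.Def.archi_bound _ => hN; exists N => n le_Nn.
have hK : K / (a - 1) < n%:R.
  by apply: le_lt_trans (ler_norm _) (lt_le_trans hN _); rewrite ler_nat.
by move: hK; rewrite ltr_pdivrMr // => hK; have := bern n; lra.
Qed.

(** * The set [D(X)] of polynomials and its closure properties *)

(** The union of the [D_n(X)]: these are nested, so [f] and [g] need no common stage. Rational
    coefficients let divisibility by a minimal polynomial apply directly. *)
Inductive Dpoly : {poly rat} -> Prop :=
| Dpoly0 : Dpoly 0
| Dpoly1 : Dpoly 1
| DpolyX f g : Dpoly f -> Dpoly g -> Dpoly ('X * f + (1 - 'X) * g).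

(** By induction on [h]: the combination with weight ['X * h1 + (1 - 'X) * h2] is the
    ['X]-combination of those with weights [h1] and [h2]. *)
Lemma Dpoly_comb h f g :
  Dpoly h -> Dpoly f -> Dpoly g -> Dpoly (h * f + (1 - h) * g).
Proof.
move=> Dh Df Dg; elim: Dh => [||h1 h2 _ IH1 _ IH2].
- by rewrite mul0r subr0 mul1r add0r.
- by rewrite subrr mul0r mul1r addr0.
- have := DpolyX _ _ IH1 IH2; congr Dpoly; ring.
Qed.

Lemma DpolyM f g : Dpoly f -> Dpoly g -> Dpoly (f * g).
Proof.
by move=> Df Dg; have := Dpoly_comb _ _ _ Df Dg Dpoly0; rewrite mulr0 addr0.
Qed.

Lemma Dpoly_exp f n : Dpoly f -> Dpoly (f ^+ n).
Proof.
move=> Df; elim: n => [|n IHn]; first exact: Dpoly1.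
by rewrite exprS; apply: DpolyM.
Qed.

Lemma Dpoly_compl f : Dpoly f -> Dpoly (1 - f).
Proof.
move=> Df; have := Dpoly_comb _ _ _ Df Dpoly0 Dpoly1.
by rewrite mulr0 add0r mulr1.
Qed.

Lemma Dpoly_X : Dpoly 'X.
Proof.
by have := DpolyX _ _ Dpoly1 Dpoly0; rewrite mulr1 mulr0 addr0.
Qed.

(** * Two approximation facts on powers of real numbers *)

(* After division by [a^(2n)] and [b^(2n)], the claim compares [a^k u^n] and
   [b^k v^n] with 1, where [u = (1 - 1/a)^2 < v = (1 - 1/b)^2]; [k] is the last
   exponent with [a^k u^n < 1], and [n] is such that [(v/u)^n > b]. *)
Lemma compare_exp (R : archiRealFieldType) (a b : R) : 1 < a -> a < b ->
  exists k n, a ^+ k * (1 - a) ^+ n.*2 < a ^+ n.*2 /\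
              b ^+ n.*2 < b ^+ k * (1 - b) ^+ n.*2.
Proof.
move=> a1 ab; pose u := ((a - 1) / a) ^+ 2; pose v := ((b - 1) / b) ^+ 2.
have a0 : 0 < a by lra.
have b0 : 0 < b by lra.
have qa0 : 0 < (a - 1) / a by rewrite divr_gt0 //; lra.
have qa1 : (a - 1) / a < 1 by rewrite ltr_pdivrMr //; lra.
have qab : (a - 1) / a < (b - 1) / b.
  by rewrite ltr_pdivrMr // mulrAC ltr_pdivlMr //; lra.
have u0 : 0 < u by rewrite exprn_gt0.
have u1 : u < 1 by rewrite expr_lt1 // ltW.
have uv : u < v by rewrite ltr_pXn2r // nnegrE ltW //; lra.
have vu1 : 1 < v / u by rewrite ltr_pdivlMr // mul1r.
have [n0 hn0] := expr_unbounded R _ b vu1.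
have [n n_gt0 hn] : exists2 n, (0 < n)%N & b < (v / u) ^+ n.
  by exists n0.+1 => //; apply: hn0.
have un0 : 0 < u ^+ n by rewrite exprn_gt0.
have un1 : u ^+ n < 1 by rewrite expr_lt1 // ltW.
have exk : exists k, 1 <= a ^+ k * u ^+ n.
  have [N hN] := expr_unbounded R _ (u ^+ n)^-1 a1.
  by exists N; rewrite -ler_pdivrMr // mul1r ltW // hN.
case: (ex_minnP exk) => -[|k]; first by rewrite expr0 mul1r leNgt un1.
move=> hk kmin; exists k, n.
have ltk : a ^+ k * u ^+ n < 1.
  by rewrite ltNge; apply/negP => /kmin; rewrite ltnn.
have expE (c : R) : c != 0 ->
    (1 - c) ^+ n.*2 = (((c - 1) / c) ^+ 2) ^+ n * c ^+ n.*2.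
  by move=> c0; rewrite -mul2n !exprM -exprMn; congr (_ ^+ n); field.
have an0 : 0 < a ^+ n.*2 by rewrite exprn_gt0.
have bn0 : 0 < b ^+ n.*2 by rewrite exprn_gt0.
rewrite !expE ?gt_eqF // -/u -/v !mulrA gtr_pMl // ltr_pMl //; split=> //.
have leab : a ^+ k.+1 <= b ^+ k.+1 by rewrite lerXn2r ?nnegrE ?ltW.
have : b * 1 < b ^+ k.+1 * v ^+ n.
  have vE : v ^+ n = (v / u) ^+ n * u ^+ n.
    by rewrite -exprMn divfK // gt_eqF.
  have : 1 <= b ^+ k.+1 * u ^+ n by apply: le_trans hk _; rewrite ler_pM2r.
  rewrite vE mulr1 mulrCA => h; apply: lt_le_trans hn _.
  by rewrite ler_peMr // exprn_ge0 // ltW // (lt_trans _ vu1).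
by rewrite exprS -mulrA ltr_pM2l.
Qed.

(* The numbers [A^i B^(n-i)] cover [[B^n, A^n]] with ratio [A / B], and these
   intervals overlap as soon as [(A / B)^n >= B]. *)
Lemma multiplicative_gap (R : archiRealFieldType) (A B : R) : 1 < B -> B < A ->
  exists K, forall x, K < x ->
    exists i j, A ^+ i * B ^+ j < x <= A / B * (A ^+ i * B ^+ j).
Proof.
move=> B1 BA; pose r := A / B; have B0 : 0 < B by lra.
have r1 : 1 < r by rewrite ltr_pdivlMr // mul1r.
have AE : A = r * B by rewrite divfK ?gt_eqF.
have [N hN] := expr_unbounded R _ B r1; exists (B ^+ N) => x ltNx.
have exn : exists n, x <= B ^+ n.
  by have [n hn] := expr_unbounded R _ x B1; exists n; rewrite ltW ?hn.
case: (ex_minnP exn) => n hn nmin.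
have ltNn : (N < n)%N.
  rewrite ltnNge; apply/negP => lenN.
  have : B ^+ n <= B ^+ N by rewrite ler_eXn2l.
  lra.
case: n => // n in hn nmin ltNn *.
have ltnx : B ^+ n < x by rewrite ltNge; apply/negP => /nmin; rewrite ltnn.
have exi : exists i, x <= r ^+ i * B ^+ n.
  exists n; apply: le_trans hn _; rewrite exprS ler_pM2r ?exprn_gt0 //.
  by rewrite ltW // hN.
case: (ex_minnP exi) => -[|i] hi imin; first by rewrite mul1r leNgt ltnx in hi.
have lein : (i <= n)%N.
  apply/ltnW/imin; apply: le_trans hn _; rewrite exprS ler_pM2r ?exprn_gt0 //.
  by rewrite ltW // hN.
have AB : A ^+ i * B ^+ (n - i) = r ^+ i * B ^+ n.
  by rewrite [in LHS]AE exprMn -mulrA -exprD subnKC.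
exists i, (n - i)%N; rewrite AB -/r mulrA -exprS hi andbT.
by rewrite ltNge; apply/negP => /imin; rewrite ltnn.
Qed.

(** * Two ring morphisms from the rational polynomials to the reals *)

Section TwoPlaces.
Variables (R : realType) (phi psi : {rmorphism {poly rat} -> R}).
Implicit Types f g Y : {poly rat}.

(** Take [C = z - Y^K (z - y)]: for large [K] the term [Y^K (z - y)] dominates, and it is positive
    under [phi] and negative under [psi]. *)
Lemma separate_lt Y y z : Dpoly Y -> Dpoly y -> Dpoly z ->
  1 < phi Y -> 1 < psi Y -> phi y < phi z -> psi z < psi y ->
  exists2 C, Dpoly C & phi C < 0 /\ 1 < psi C.
Proof.
move=> DY Dy Dz aY bY ltyz ltzy.
have d0 : 0 < phi z - phi y by lra.
have e0 : 0 < psi y - psi z by lra.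
have [N hN] := expr_unbounded R _ (phi z / (phi z - phi y)) aY.
have [M hM] := expr_unbounded R _ ((1 - psi z) / (psi y - psi z)) bY.
exists (Y ^+ (N + M) * y + (1 - Y ^+ (N + M)) * z).
  by apply: Dpoly_comb => //; apply: Dpoly_exp.
have := hN (N + M)%N (leq_addr _ _); have := hM (N + M)%N (leq_addl _ _).
rewrite !ltr_pdivrMr // !(rmorphD, rmorphN, rmorphM, rmorphXn, rmorph1).
by move=> h1 h2; split; lra.
Qed.

Lemma separate Y : Dpoly Y -> 1 < phi Y -> phi Y < psi Y ->
  exists2 C, Dpoly C & phi C < 0 /\ 1 < psi C.
Proof.
move=> DY a1 ab; have b1 := lt_trans a1 ab.
have [k [n [h1 h2]]] := compare_exp _ _ _ a1 ab.
apply: (separate_lt Y (Y ^+ k * (1 - Y) ^+ n.*2) (Y ^+ n.*2)) => //.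
- by apply: DpolyM; apply: Dpoly_exp => //; apply: Dpoly_compl.
- exact: Dpoly_exp.
- by rewrite !(rmorphM, rmorphB, rmorphXn, rmorph1).
- by rewrite !(rmorphM, rmorphB, rmorphXn, rmorph1).
Qed.

Hypothesis eq_ker : forall f, (phi f == 0) = (psi f == 0).

Lemma eq_kerB f g : (phi f == phi g) = (psi f == psi g).
Proof. by rewrite -subr_eq0 -rmorphB eq_ker rmorphB subr_eq0. Qed.

(** Equal kernels make [psi f] a function of [phi f], so only finitely many values compete. The
    induction on [s] decides classically which entries are attained. *)
Lemma psi_argmax (s : seq R) :
  (exists2 f, Dpoly f & phi f \in s) ->
  exists f, [/\ Dpoly f, phi f \in s &
    forall g, Dpoly g -> phi g \in s -> psi g <= psi f].
Proof.
have eq_psi f g : phi f = phi g -> psi f = psi g.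
  by move=> /eqP; rewrite eq_kerB => /eqP.
elim: s => [[]//|x s IHs] exf.
have [exs|nexs] := pselect (exists2 f, Dpoly f & phi f \in s); last first.
  have only_x g : Dpoly g -> phi g \in x :: s -> phi g = x.
    rewrite inE => Dg /orP[/eqP//|gs]; case: nexs; by exists g.
  have [f Df fs] := exf; exists f; split=> // g Dg gs.
  by rewrite (eq_psi g f) ?lexx //; rewrite (only_x g Dg gs) (only_x f Df fs).
have [f0 [Df0 f0s f0max]] := IHs exs.
have [[f Df fx]|nexx] := pselect (exists2 f, Dpoly f & phi f = x).
  have [leff0|ltf0f] := leP (psi f) (psi f0).
    exists f0; split=> // [|g Dg]; first by rewrite inE f0s orbT.
    rewrite inE => /orP[/eqP gx|]; last exact: f0max.
    by rewrite (eq_psi g f) ?lexx // gx.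
  exists f; split=> // [|g Dg]; first by rewrite inE fx eqxx.
  rewrite inE => /orP[/eqP gx|gs]; first by rewrite (eq_psi g f) ?lexx // gx.
  by apply: le_trans (f0max _ Dg gs) (ltW ltf0f).
exists f0; split=> // [|g Dg]; first by rewrite inE f0s orbT.
rewrite inE => /orP[/eqP gx|]; last exact: f0max.
by case: nexx; exists g.
Qed.

Lemma overshoot_in_interval C : Dpoly C -> phi C < 0 ->
  exists L, 1 <= L /\ forall f, Dpoly f -> 1 - L <= phi f <= L ->
    exists g, [/\ Dpoly g, phi g != phi f, 1 - L <= phi g <= L &
      1 - L <= phi (C * f + (1 - C) * g) <= L].
Proof.
move=> DC C0; pose m := - phi C.
have m0 : 0 < m by rewrite /m; lra.
(* [A] and [B] are the values under [phi] of [(1 - C)^2] and [1 - C + C^2]. *)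
pose A := (1 + m) ^+ 2; pose B := 1 + m * (1 + m).
have B1 : 1 < B by rewrite /B; nra.
have BA : B < A by rewrite /A /B; nra.
have [K0 hK0] := multiplicative_gap R _ _ B1 BA.
pose K := 1 + `|K0|; have K1 : 1 <= K by rewrite /K lerDl.
(* This gives [1 - L <= - m * K], so that [g = 0] serves every [f] with [1 / 2 <= phi f <= K]. *)
pose L := (1 + m) * K.
have L1 : 1 <= L by rewrite /L; nra.
exists L; split=> //.
have phi_comb f g : phi (C * f + (1 - C) * g) = (1 + m) * phi g - m * phi f.
  by rewrite !(rmorphD, rmorphN, rmorphM, rmorph1) /m; ring.
have upper_half f : Dpoly f -> 1 / 2 <= phi f <= L ->
    exists g, [/\ Dpoly g, phi g != phi f, 1 - L <= phi g <= L &
      1 - L <= phi (C * f + (1 - C) * g) <= L].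
  move=> Df /andP[f2 fL]; have [leK|ltK] := leP (phi f) K.
    exists 0; rewrite phi_comb rmorph0; split; first exact: Dpoly0.
    - by rewrite lt_eqF //; lra.
    - by apply/andP; split; lra.
    - have h : m * phi f <= m * K by rewrite ler_pM2l.
      have : 0 <= m * phi f by rewrite mulr_ge0; lra.
      by rewrite /L; lra.
  have [i [j /andP[ltx lex]]] : exists i j,
      A ^+ i * B ^+ j < phi f <= A / B * (A ^+ i * B ^+ j).
    by apply: hK0; apply: le_lt_trans ltK; rewrite /K; have := ler_norm K0; lra.
  pose g := ((1 - C) ^+ 2) ^+ i * (1 - C * (1 - C)) ^+ j.
  have gE : phi g = A ^+ i * B ^+ j.
    rewrite /g !(rmorphXn, rmorphD, rmorphN, rmorphM, rmorph1) /A /B /m.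
    by congr (_ ^+ _ * _ ^+ _); ring.
  have g0 : 0 < phi g by rewrite gE mulr_gt0 // exprn_gt0 //; lra.
  move: ltx lex; rewrite -gE => ltx lex.
  exists g; rewrite phi_comb; split.
  - by apply: DpolyM; do ?[apply: Dpoly_exp | apply: Dpoly_compl | apply: DpolyM].
  - by rewrite lt_eqF.
  - by apply/andP; split; lra.
  (* Together with [phi g < phi f <= A / B * phi g], this bound keeps the new point in
     [[0, phi g]]. *)
  - have mr : m * (A / B) <= 1 + m.
      by rewrite mulrA ler_pdivrMr ?(lt_trans _ B1) // /A /B; nra.
    have h1 : m * phi f <= (1 + m) * phi g.
      apply: (@le_trans _ _ (m * (A / B * phi g))); first by rewrite ler_pM2l.
      by rewrite mulrA ler_pM2r.
    have h2 : m * phi g <= m * phi f by rewrite ler_pM2l // ltW.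
    by apply/andP; split; lra.
move=> f Df /andP[fL Lf].
have [le2|lt2] := leP (1 / 2) (phi f); first by apply: upper_half; rewrite ?le2.
(* The lower half follows by [f |-> 1 - f], which preserves [[1 - L, L]] and commutes with the
   combination. *)
have fc : phi (1 - f) = 1 - phi f by rewrite rmorphB rmorph1.
have [||g [Dg gf gL combL]] := upper_half (1 - f); first exact: Dpoly_compl.
  by rewrite fc; apply/andP; split; lra.
exists (1 - g); move: gf gL combL; rewrite !phi_comb fc rmorphB rmorph1.
move=> gf gL combL; split; first exact: Dpoly_compl.
- by apply: contra gf => /eqP <-; rewrite opprB addrCA subrr addr0.
- by apply/andP; split; lra.
- by apply/andP; split; lra.
Qed.

Lemma no_opposite_signs C :
  (forall l u, finite_set ([set phi f | f in Dpoly] `&` `[l, u])) ->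
  Dpoly C -> phi C < 0 -> 1 < psi C -> False.
Proof.
move=> fin DC C0 C1; have [L [L1 hL]] := overshoot_in_interval C DC C0.
have /finite_seqP[s sE] := fin (1 - L) L.
have memS f : Dpoly f -> (phi f \in s) = (1 - L <= phi f <= L).
  move=> Df; apply/idP/idP => [fs|fL].
    have : [set` s] (phi f) by [].
    by rewrite -sE => -[_]; rewrite /= in_itv.
  suff : [set` s] (phi f) by [].
  by rewrite -sE; split; [exists f|rewrite /= in_itv].
have [|f [Df fs fmax]] := psi_argmax s.
  by exists 0; [exact: Dpoly0|rewrite memS ?rmorph0; [lra|exact: Dpoly0]].
have [g [Dg gf gL combL]] := hL f Df (etrans (esym (memS _ Df)) fs).
have Dcomb := Dpoly_comb _ _ _ DC Df Dg.
have := fmax _ Dcomb; rewrite memS // combL => /(_ isT).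
have := fmax _ Dg; rewrite memS // gL => /(_ isT).
rewrite le_eqVlt -eq_kerB (negPf gf) /= => ltgf.
rewrite !(rmorphD, rmorphN, rmorphM, rmorph1) => hle.
(* This product is the amount by which the new element exceeds the maximum [psi f]. *)
suff : 0 < (psi C - 1) * (psi f - psi g) by lra.
by rewrite mulr_gt0 ?subr_gt0.
Qed.

End TwoPlaces.

(** Finiteness is assumed for [phi] only, so when [psi Y < phi Y] the polynomial [C] is found with
    the two morphisms exchanged and then replaced by [1 - C]. *)
Lemma no_common_side (R : realType) (phi psi : {rmorphism {poly rat} -> R}) :
  (forall f, (phi f == 0) = (psi f == 0)) ->
  (forall l u, finite_set ([set phi f | f in Dpoly] `&` `[l, u])) ->
  forall Y, Dpoly Y -> 1 < phi Y -> 1 < psi Y -> phi Y != psi Y -> False.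
Proof.
move=> eq_ker fin Y DY aY bY; rewrite neq_lt => /orP[] lt_ab.
  have [C DC [C0 C1]] := separate _ phi psi Y DY aY lt_ab.
  exact: (no_opposite_signs _ phi psi eq_ker C fin).
have [C DC [C0 C1]] := separate _ psi phi Y DY bY lt_ab.
apply: (no_opposite_signs _ phi psi eq_ker (1 - C) fin).
- exact: Dpoly_compl.
- by rewrite rmorphB rmorph1; lra.
- by rewrite rmorphB rmorph1; lra.
Qed.

(** * Evaluation at a real number and at its conjugates *)

Definition evalQ (R : realType) (x : R) : {rmorphism {poly rat} -> R} :=
  horner_eval x \o map_poly ratr.

Lemma evalQE (R : realType) (x : R) f : evalQ R x f = (map_poly ratr f).[x].
Proof. by []. Qed.

Lemma evalQX (R : realType) (x : R) : evalQ R x 'X = x.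
Proof. by rewrite evalQE map_polyX hornerX. Qed.

Lemma evalQ_dvd (R : realType) (x : R) f g :
  f %| g -> evalQ R x f = 0 -> evalQ R x g = 0.
Proof. by move=> /dvdpP[h ->]; rewrite rmorphM => /= ->; rewrite mulr0. Qed.

Lemma minimal_poly_dvdp (R : realType) (a : R) p q :
  minimal_poly a p -> evalQ R a q = 0 -> p %| q.
Proof.
move=> [monp rootp minp] qa0.
have p0 := monic_neq0 monp.
apply/modp_eq0P/eqP; apply: contraT => r0.
have := minp _ r0; rewrite leqNgt ltn_modp p0 => /(_ _)/negP; case=> //.
have : evalQ R a (q %/ p * p + q %% p) = 0 by rewrite -divp_eq.
rewrite rmorphD rmorphM (_ : evalQ R a p = 0); last exact/rootP.
by rewrite mulr0 add0r => /rootP.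
Qed.

Lemma minimal_poly_eq_ker (R : realType) (a b : R) p :
  minimal_poly a p -> root (map_poly ratr p) b ->
  forall f, (evalQ R a f == 0) = (evalQ R b f == 0).
Proof.
move=> minp pb f; apply/eqP/eqP => [/(minimal_poly_dvdp _ _ _ _ minp) pf|fb].
  by apply: evalQ_dvd pf _; apply/rootP.
have [monp /rootP pa min_size] := minp; have p0 := monic_neq0 monp.
(* [g] vanishes at [b], hence is not constant. Its cofactor [h] in [p] is then smaller than [p] and
   by minimality cannot vanish at [a], so [g] does. *)
pose g := gcdp p f.
have gb : root (map_poly ratr g) b.
  by rewrite gcdp_map root_gcd pb; apply/rootP.
have /dvdpP[h hE] : g %| p by apply: dvdp_gcdl.
have [h0 g0] : h != 0 /\ g != 0.
  by apply/andP; rewrite -negb_or -mulf_eq0 -hE.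
have : evalQ R a h * evalQ R a g == 0 by rewrite -rmorphM -hE; apply/eqP.
rewrite mulf_eq0 => /orP[/eqP/rootP ha|/eqP]; last first.
  by apply: evalQ_dvd; apply: dvdp_gcdr.
have := min_size _ h0 ha; rewrite hE size_mul //.
have : (1 < size (map_poly (ratr : rat -> R) g))%N.
  by apply: root_size_gt1 gb; rewrite map_poly_eq0.
rewrite size_map_poly; case: (size g) => [|[|n]] // _.
by rewrite !addnS ltnNge leq_addr.
Qed.

(** * Consequences of sparsity *)

Lemma D_evalQ (R : realType) (a : R) f : Dpoly f -> D a (evalQ R a f).
Proof.
move=> Df V [Vconv V01]; elim: Df => [||f1 f2 _ IH1 _ IH2].
- by rewrite rmorph0; apply: V01; left.
- by rewrite rmorph1; apply: V01; right.
- by rewrite !(rmorphD, rmorphN, rmorphM, rmorph1) evalQX; apply: Vconv.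
Qed.

(** Bolzano-Weierstrass: an infinite bounded part of [D a] would yield a limit point. *)
Lemma sparse_finite (R : realType) (a l u : R) :
  sparse a -> finite_set (D a `&` `[l, u]).
Proof.
move=> spa; apply: contrapT => /infinite_bounded_limit_point_nonempty[].
  have [M [realM hM]] := compact_bounded (@segment_compact R l u).
  by exists M; split=> // y My x [_ xlu]; apply: hM My x xlu.
move=> x xlim; have : limit_point (D a) x.
  by move=> U /xlim[y [yx [Dy _] Uy]]; exists y.
by rewrite spa.
Qed.

Lemma sparse_evalQ (R : realType) (a : R) : sparse a ->
  forall l u, finite_set ([set evalQ R a f | f in Dpoly] `&` `[l, u]).
Proof.
move=> spa l u; apply: sub_finite_set (sparse_finite _ _ l u spa).
by apply: setSI => _ [f Df <-]; apply: D_evalQ.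
Qed.

(** The powers [a ^+ n] would be infinitely many distinct points of [D a] in [[0, 1]]. *)
Lemma sparse_notin01 (R : realType) (a : R) : sparse a -> 0 < a < 1 -> False.
Proof.
move=> spa /andP[a0 a1].
apply: infinite_nat.
have -> : [set: nat] = (GRing.exp a) @^-1` (D a `&` `[0, 1]).
  apply/seteqP; split=> // n _; split; last first.
    by rewrite /= in_itv /= exprn_ge0 ?exprn_ile1 // ltW.
  have := D_evalQ _ a _ (Dpoly_exp _ n Dpoly_X).
  by rewrite rmorphXn evalQX.
apply: finite_preimage; last exact: sparse_finite.
by move=> m n _ _; apply: ieexprIn; rewrite // lt_eqF.
Qed.

(** * Location of the conjugates *)

Theorem theorem2 (R : realType) (a : R) :
  totally_real a -> algebraic_integer a -> sparse a ->
  forall z : R[i], conjugate a z -> z <> a%:C ->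
    exists2 b : R, z = b%:C & 0 < b < 1.
Proof.
move=> [_ reala] _ spa z conjz; have [b zE] := reala z conjz; subst z.
move=> ba; exists b => //; case: conjz => p minp.
(* The coefficients embed into [R[i]] through [R], so [p] vanishes at [b] already over [R]. *)
have -> : map_poly ratr p = map_poly (real_complex R) (map_poly ratr p).
  rewrite -map_poly_comp; apply: eq_map_poly => x /=.
  by rewrite fmorph_rat.
rewrite fmorph_root => pb.
have eq_ker := minimal_poly_eq_ker _ _ _ _ minp pb.
have neq_ba : b != a by apply: contra_notN ba => /eqP ->.
(* Equal kernels, tested on ['X] and ['X - 1], let [a] and [b] take the value 0 or 1 only together,
   which [b != a] excludes. *)
have eq0 : (a == 0) = (b == 0) by have := eq_ker 'X; rewrite !evalQX.
have eq1 : (a == 1) = (b == 1).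
  have := eq_ker ('X - 1).
  by rewrite !(rmorphB, rmorph1) !evalQX !subr_eq0.
have fin := sparse_evalQ _ _ spa.
have outside (c : R) : c != 0 -> c != 1 -> ~ 0 < c < 1 -> c < 0 \/ 1 < c.
  move=> c0 c1 nc; have [c_lt0|c_gt0|c_eq0] := ltgtP c 0; first by left.
    have [c_lt1||c_eq1] := ltgtP c 1; [|by right|by rewrite c_eq1 eqxx in c1].
    by case: nc; rewrite c_gt0.
  by rewrite c_eq0 eqxx in c0.
have [a_eq0|a0] := eqVneq a 0.
  by move: eq0 neq_ba; rewrite a_eq0 eqxx => /esym/eqP->; rewrite eqxx.
have [a_eq1|a1] := eqVneq a 1.
  by move: eq1 neq_ba; rewrite a_eq1 eqxx => /esym/eqP->; rewrite eqxx.
apply: contrapT => nb.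
have ha := outside a a0 a1 (sparse_notin01 _ _ spa).
have hb : b < 0 \/ 1 < b by apply: outside => //; rewrite -?eq0 -?eq1.
(* With [a] and [b] on the same side of [[0, 1]], one of ['X] and [1 - 'X] exceeds 1 at both; on
   opposite sides, one of them is negative at [a] and exceeds 1 at [b]. *)
case: ha hb => ha [hb|hb].
- apply: (no_common_side _ _ _ eq_ker fin (1 - 'X)).
  + exact/Dpoly_compl/Dpoly_X.
  + by rewrite rmorphB rmorph1 evalQX; lra.
  + by rewrite rmorphB rmorph1 evalQX; lra.
  + by rewrite !(rmorphB, rmorph1) !evalQX (inj_eq (subrI _)) eq_sym.
- apply: (no_opposite_signs _ _ _ eq_ker 'X fin); rewrite ?evalQX //.
  exact: Dpoly_X.
- apply: (no_opposite_signs _ _ _ eq_ker (1 - 'X) fin).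
  + exact/Dpoly_compl/Dpoly_X.
  + by rewrite rmorphB rmorph1 evalQX; lra.
  + by rewrite rmorphB rmorph1 evalQX; lra.
- apply: (no_common_side _ _ _ eq_ker fin 'X); rewrite ?evalQX //.
    exact: Dpoly_X.
  by rewrite eq_sym.
Qed.
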